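(* Let $G=([n],E)$ be an undirected graph and let $H$ be an induced subgraph of $G$ such that there is an odd circuit in $G$ through the vertices of $H$ (i.e. an odd circuit whose vertex set is exactly the vertex set of $H$). Then $\mathbf{e}(H)$, the normal of the rank inequality $\mathbf{x}(H) \leq \alpha(H)$, appears in $\mathcal{A}_G^{(1)}$. In particular, the normals of all odd hole inequalities and of all odd clique inequalities (for cliques with an odd number, at least three, of vertices) appear in $\mathcal{A}_G^{(1)}$.
   Context: Graphs are simple. $\mathbf{e}_i$ is the $i$th standard unit vector of $\mathbb{R}^n$; for a subgraph $H$ with vertex set $V_H$, $\mathbf{e}(H) = \sum_{i \in V_H} \mathbf{e}_i$ and $\mathbf{x}(H) = \sum_{i \in V_H} x_i$. $\alpha(H)$ is the maximum size of a stable (independent) set in $H$. A circuit in $G$ is a closed walk with distinct vertices and edges; it is odd if it has an odd number of vertices. A hole is a chordless circuit. The odd hole inequality of an odd hole $C$ is $\mathbf{x}(C) \leq \lfloor |C|/2 \rfloor$, with normal $\mathbf{e}(C)$; the clique inequality of a clique $K$ is $\mathbf{x}(K) \leq 1$, with normal $\mathbf{e}(K)$. Let $\mathcal{A}_G := \{\mathbf{e}_i + \mathbf{e}_j : \{i,j\} \in E\} \cup \{-\mathbf{e}_i : i \in [n]\}$. A basis in a set of vectors of $\mathbb{Z}^n$ is a subset of $n$ linearly independent vectors, and the cone generated by it is a basis cone. The minimal Hilbert basis of a pointed rational cone $K$ is the unique minimal finite set $H \subset K \cap \mathbb{Z}^n$ such that every element of $K \cap \mathbb{Z}^n$ is a nonnegative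 integer combination of elements of $H$. Set $\mathcal{A}_G^{(0)} = \mathcal{A}_G$, and for $k \geq 1$ let $\mathcal{A}_G^{(k)}$ be the union of the minimal Hilbert bases of all basis cones of $\mathcal{A}_G^{(k-1)}$. *)

(* Defs.v *)
From HB Require Import structures.
From mathcomp Require Import all_boot all_order all_algebra finmap.
From mathcomp Require Import classical_sets reals.

Set Implicit Arguments.
Unset Strict Implicit.
Unset Printing Implicit Defensive.

Import Order.TTheory GRing.Theory Num.Theory.
Local Open Scope ring_scope.
Local Open Scope classical_set_scope.

Section Graph.
Variables (n : nat) (e : rel 'I_n).

(* A closed walk x_0, ..., x_(k-1), x_0 is given by the sequence of its x_i;
   distinctness of the edges {x_i, x_(i+1)} excludes going back and forth
   along a single edge. *)
Definition circuit (c : seq 'I_n) : bool :=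
  [&& c != [::], cycle e c, uniq c
    & uniq [seq ([set x; next c x]%SET : {set 'I_n}) | x <- c]].

Definition odd_circuit (c : seq 'I_n) : bool := circuit c && odd (size c).

Definition chordless (c : seq 'I_n) : Prop :=
  {in c &, forall x y, e x y -> y = next c x \/ x = next c y}.

(* Triangles count as holes. *)
Definition odd_hole (c : seq 'I_n) : Prop := odd_circuit c /\ chordless c.

Definition clique (K : {set 'I_n}) : Prop :=
  {in K &, forall x y, x != y -> e x y}.

Definition stable (S : {set 'I_n}) : bool :=
  [forall x in S, forall y in S, ~~ e x y].

(* Stability number of the subgraph induced by V. *)
Definition alpha (V : {set 'I_n}) : nat :=
  \max_(S : {set 'I_n} | (S \subset V) && stable S) #|S|.

Definition unit_vec (i : 'I_n) : 'rV[int]_n := delta_mx 0 i.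

Definition evec (V : {set 'I_n}) : 'rV[int]_n := \sum_(i in V) unit_vec i.

(* [LinIneq a b] stands for the inequality a x <= b. *)
Record lin_ineq := LinIneq { normal : 'rV[int]_n; rhs : int }.

Definition rank_ineq (V : {set 'I_n}) : lin_ineq :=
  LinIneq (evec V) (alpha V)%:Z.

Definition odd_hole_ineq (c : seq 'I_n) : lin_ineq :=
  LinIneq (evec [set:: c]%SET) (size c)./2%:Z.

Definition clique_ineq (K : {set 'I_n}) : lin_ineq := LinIneq (evec K) 1.

Definition A_graph : set 'rV[int]_n :=
  [set v | (exists i j, e i j /\ v = unit_vec i + unit_vec j)
           \/ exists i, v = - unit_vec i].

End Graph.

Section HilbertBases.
Variables (R : realFieldType) (n : nat).
Implicit Types (A : set 'rV[int]_n) (B H : {fset 'rV[int]_n}).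
Implicit Types (K : set 'rV[R]_n).

Definition toR (v : 'rV[int]_n) : 'rV[R]_n := map_mx intr v.

Definition basis_in A B : Prop :=
  [/\ forall b, b \in B -> A b, #|` B|%fset = n
    & free [seq toR b | b <- enum_fset B]].

Definition cone B : set 'rV[R]_n :=
  [set x | exists c : 'rV[int]_n -> R,
     (forall b, b \in B -> 0 <= c b) /\ x = \sum_(b <- enum_fset B) c b *: toR b].

Definition lattice_points K : set 'rV[int]_n := [set v | K (toR v)].

Definition hilbert_basis K H : Prop :=
  (forall h, h \in H -> lattice_points K h) /\
  (forall v, lattice_points K v ->
     exists c : 'rV[int]_n -> nat, v = \sum_(h <- enum_fset H) h *+ c h).

Definition min_hilbert_basis K H : Prop :=
  hilbert_basis K H /\
  (forall H', hilbert_basis K H' -> H' `<=` H -> H' = H)%fset.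

Definition hilbert_step A : set 'rV[int]_n :=
  [set v | exists B H,
     [/\ basis_in A B, min_hilbert_basis (cone B) H & v \in H]].

Definition A_iter (e : rel 'I_n) (k : nat) : set 'rV[int]_n :=
  iter k hilbert_step (A_graph e).

End HilbertBases.

(* Main.v *)
Require Import Defs.
From mathcomp Require Import all_boot all_order all_algebra.
From mathcomp Require Import classical_sets reals.
From mathcomp Require Import finmap boolp lra zify.

Set Implicit Arguments.
Unset Strict Implicit.
Unset Printing Implicit Defensive.

(** Let [c] be an odd circuit with vertex set [V].  The generators
    [e_x + e_(next x)], for [x] on [c], together with [- e_j], for [j] off [c],
    form a basis in the vectors of the graph.  Comparing coordinates, a
    combination with coefficients [a] has coordinate [a x + a (next x)] at the
    vertex following [x] and [- a j] at a vertex [j] off [c].  If these lie in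
    an additive subgroup [S] of the reals, then [a] changes sign modulo [S] at
    each step along [c]; going once around an odd circuit gives
    [a x = - a x] modulo [S].  This is used twice.

    With [S = 0] it gives [2 a = 0], that is, linear independence.  With [S] the
    integers it shows that the coefficients of a lattice point of the cone are
    half-integers on [c], all congruent to each other modulo 1.  Now [e(V)] is
    half the sum of the generators on [c], so after subtracting [e(V)] once if
    necessary all coefficients are natural numbers: the generators and [e(V)]
    together form a Hilbert basis of the cone.

    Finally, [e(V)] belongs to every Hilbert basis contained in that one: the
    sum of the coordinates over [V] is even at every generator, but is the odd
    number [#|V|] at [e(V)].  In particular it belongs to a minimal one. *)

(** * Alternating functions on odd cycles *)

Section AlternatingOnCycle.
Import GRing.Theory.
Local Open Scope ring_scope.

Variables (T : finType) (U : zmodType) (S : U -> Prop).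
Variables (c : seq T) (a : T -> U).
Hypotheses (S0 : S 0) (SB : forall u v, S u -> S v -> S (u - v)).
Hypotheses (c_uniq : uniq c) (c_odd : odd (size c)).
Hypothesis aS : forall x, x \in c -> S (a x + a (next c x)).

Lemma mem_iter_next x m : x \in c -> iter m (next c) x \in c.
Proof. by move=> xc; elim: m => //= m; rewrite mem_next. Qed.

Lemma alternating_iter_next x m : x \in c ->
  S (if odd m then a (iter m (next c) x) + a x
     else a (iter m (next c) x) - a x).
Proof.
move=> xc; elim: m => [|m IHm]; first by rewrite /= subrr.
have /SB/(_ IHm) := aS (mem_iter_next m xc).
rewrite iterS /=; move: (iter m _ x) => y.
by rewrite (addrC (a y)); case: (odd m) => /=; rewrite addrKA ?opprK.
Qed.

(** Going once around reverses the sign, since the length is odd. *)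
Lemma alternating_double x : x \in c -> S (a x + a x).
Proof.
move=> xc; have := alternating_iter_next (size c) xc.
have c_next := cycle_next c_uniq.
by rewrite c_odd -(order_cycle c_next c_uniq xc) (iter_order_cycle c_next xc xc).
Qed.

Lemma alternating_sub x y : x \in c -> y \in c -> S (a y - a x).
Proof.
move=> xc yc.
have xy : fconnect (next c) x y by rewrite (fconnect_cycle (cycle_next c_uniq) xc).
have := alternating_iter_next (findex (next c) x y) xc.
rewrite (iter_findex xy); case: odd => // Sxy.
by have := SB Sxy (alternating_double xc); rewrite opprD addrA addrK.
Qed.

End AlternatingOnCycle.

(** * Minimal Hilbert bases and cones of finite families *)

Section HilbertBases.
Import GRing.Theory Num.Theory.
Local Open Scope ring_scope.
Local Open Scope fset_scope.

Variables (R : realFieldType) (n : nat).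
Implicit Types (K : set 'rV[R]_n) (H : {fset 'rV[int]_n}).

Lemma sub_min_hilbert_basis K H : hilbert_basis K H ->
  exists2 H', min_hilbert_basis K H' & H' `<=` H.
Proof.
have [m] := ubnP #|` H|; elim: m H => // m IHm H; rewrite ltnS => le_Hm hH.
have [[H' [hH' ltH']]|minH] := EM (exists H', hilbert_basis K H' /\ H' `<` H).
  have [|H2 minH2 sH2] := IHm H' _ hH'.
    exact: leq_trans (fproper_ltn_card ltH') le_Hm.
  by exists H2; rewrite // (fsubset_trans sH2 (fproper_sub ltH')).
exists H => //; split=> // H' hH' sH'; apply/eqP; apply: contrapT => /negP neH.
by apply: minH; exists H'; split; rewrite // fproperEneq neH.
Qed.

Lemma perm_imfset (I : finType) (g : I -> 'rV[int]_n) : injective g ->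
  perm_eq (enum_fset [fset g i | i in I]) [seq g i | i <- index_enum I].
Proof.
move=> g_inj; apply: uniq_perm; rewrite ?fset_uniq ?map_inj_uniq ?index_enum_uniq //.
move=> v; apply/imfsetP/mapP => -[i iI ->]; exists i => //.
Qed.

Lemma sum_imfset (I : finType) (g : I -> 'rV[int]_n) (W : nmodType)
    (F : 'rV[int]_n -> W) : injective g ->
  \sum_(v <- enum_fset [fset g i | i in I]) F v = \sum_i F (g i).
Proof.
by move=> g_inj; rewrite (perm_big _ (perm_imfset g_inj)) big_map.
Qed.

(** Coefficients indexed by a family become coefficients indexed by vectors by
    adding those of equal vectors; injectivity leaves a single term. *)
Lemma coef_of_inj (I : finType) (g : I -> 'rV[int]_n) (W : nmodType)
    (a : I -> W) i : injective g -> \sum_(j | g j == g i) a j = a i.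
Proof.
by move=> g_inj; rewrite (big_pred1 i) // => j; rewrite (inj_eq g_inj).
Qed.

Lemma coneP (I : finType) (g : I -> 'rV[int]_n) (x : 'rV[R]_n) : injective g ->
  cone [fset g i | i in I] x <->
  exists2 a : I -> R, forall i, 0 <= a i & x = \sum_i a i *: toR R (g i).
Proof.
move=> g_inj; split=> [[k [k_ge0 ->]]|[a a_ge0 ->]].
  exists (k \o g) => [i|]; last by rewrite sum_imfset.
  by apply: k_ge0; apply: in_imfset.
exists (fun v => \sum_(i | g i == v) a i); split=> [v _|]; first exact: sumr_ge0.
by rewrite sum_imfset //; apply: eq_bigr => i _; rewrite coef_of_inj.
Qed.

Lemma toR_inj : injective (@toR R n).
Proof.
move=> u v /matrixP uv; apply/matrixP => i j.
by have /eqP := uv i j; rewrite !mxE eqr_int => /eqP.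
Qed.

Lemma toR_sum (I : finType) (g : I -> 'rV[int]_n) (N : I -> nat) :
  toR R (\sum_i g i *+ N i) = \sum_i (N i)%:R *: toR R (g i).
Proof.
rewrite /toR raddf_sum; apply: eq_bigr => i _.
by rewrite raddfMn -scaler_nat.
Qed.

Lemma free_toR_basis (A : set 'rV[int]_n) (g : 'I_n -> 'rV[int]_n) :
    (forall i, A (g i)) ->
    (forall a : 'I_n -> R, \sum_i a i *: toR R (g i) = 0 -> forall i, a i = 0) ->
  injective g /\ basis_in R A [fset g i | i in 'I_n].
Proof.
move=> Ag g_free.
have freeX : free [tuple toR R (g i) | i < n].
  apply/freeP => a a0; apply: g_free; rewrite -[RHS]a0.
  by apply: eq_bigr => i _; rewrite (nth_map i) ?size_enum_ord // nth_ord_enum.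
have g_inj : injective g.
  move=> i j gij; apply/eqP.
  have /tuple_uniqP/(_ i j) inj := free_uniq freeX.
  by rewrite inj // !tnth_mktuple gij.
split=> //; split.
- by move=> _ /imfsetP[i _ ->].
- by rewrite -sum1_size sum_imfset // sum1_card card_ord.
- rewrite (perm_free (perm_map _ (perm_imfset g_inj))) -map_comp.
  by rewrite [index_enum _]unlock -enumT; apply: freeX.
Qed.

End HilbertBases.

Section IntegralCoefficients.
Import GRing.Theory Num.Theory.
Local Open Scope ring_scope.

Variable R : archiRealFieldType.

Lemma int_or_half_int (x : R) : x + x \is a Num.int ->
  x \is a Num.int \/ x - 2^-1 \is a Num.int.
Proof.
case/intrP => m xm; have mE := divz_eq m 2.
have : (m %% 2)%Z = 0 \/ (m %% 2)%Z = 1.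
  have := ltz_pmod m (isT : 0 < 2 :> int); have := modz_ge0 m (isT : 2 != 0 :> int).
  by lia.
case=> r; rewrite {}r in mE; [left|right]; apply/intrP; exists (m %/ 2)%Z;
  by move: xm; rewrite {1}mE ?addr0 ?intrD intrM; lra.
Qed.

Lemma nat_coefs (n : nat) (I : finType) (g : I -> 'rV[int]_n) (a : I -> R) v :
    (forall i, a i \is a Num.nat) -> toR R v = \sum_i a i *: toR R (g i) ->
  v = \sum_i g i *+ Num.truncn (a i).
Proof.
move=> a_nat vE; apply: (@toR_inj R); rewrite vE toR_sum.
by apply: eq_bigr => i _; rewrite truncnK.
Qed.

End IntegralCoefficients.

(** * The basis cone of an odd circuit *)

Section OddCircuit.
Import GRing.Theory Num.Theory.
Local Open Scope ring_scope.

Variables (R : realType) (n : nat) (c : seq 'I_n).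

Definition circuit_gen (i : 'I_n) : 'rV[int]_n :=
  if i \in c then unit_vec i + unit_vec (next c i) else - unit_vec i.

Lemma evec_coord (V : {set 'I_n}) k j : evec V k j = (j \in V)%:R.
Proof.
rewrite /evec summxE; have [jV|jV] := boolP (j \in V).
  rewrite (bigD1 j) //= big1 => [|i /andP[_ /negPf ij]]; rewrite !mxE ord1 /=.
    by rewrite eqxx addr0.
  by rewrite eq_sym ij.
rewrite big1 // => i iV; rewrite !mxE ord1 /=.
by case: eqP iV jV => // <- ->.
Qed.

Hypotheses (c_uniq : uniq c) (c_odd : odd (size c)).

Lemma circuit_gen_coord i k j : circuit_gen i k j =
  if i \in c then (i == j)%:R + (i == prev c j)%:R else - (i == j)%:R.
Proof.
rewrite -(can2_eq (prev_next c_uniq) (next_prev c_uniq)) /circuit_gen ord1.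
by case: ifP => _; rewrite !mxE !eqxx /= !(eq_sym j).
Qed.

Lemma sum_coef_delta (a : 'I_n -> R) j : \sum_i a i * (i == j)%:R = a j.
Proof.
rewrite (bigD1 j) //= eqxx mulr1 big1 ?addr0 // => i /negPf ->.
by rewrite mulr0.
Qed.

Lemma sum_circuit_gen_coord (a : 'I_n -> R) k j :
  (\sum_i a i *: toR R (circuit_gen i)) k j =
  if j \in c then a j + a (prev c j) else - a j.
Proof.
rewrite summxE; case: ifPn => jc.
  rewrite -(sum_coef_delta a j) -(sum_coef_delta a (prev c j)) -big_split /=.
  apply: eq_bigr => i _; rewrite !mxE circuit_gen_coord -mulrDr; congr (_ * _).
  case: ifPn => ic; first by rewrite rmorphD /= !natz.
  have /negPf -> : i != j by apply: contraNneq ic => ->.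
  have /negPf -> : i != prev c j by apply: contraNneq ic => ->; rewrite mem_prev.
  by rewrite oppr0 addr0.
rewrite -(sum_coef_delta a j) -sumrN; apply: eq_bigr => i _.
rewrite !mxE circuit_gen_coord -mulrN; congr (_ * _).
case: ifPn => ic; last by rewrite rmorphN /= natz.
have /negPf -> : i != j by apply: contraNneq jc => <-.
have /negPf -> : i != prev c j.
  by apply: contraNneq jc => ij; rewrite -(mem_prev c) -ij.
by rewrite addr0 oppr0.
Qed.

Lemma circuit_gen_free (a : 'I_n -> R) :
  \sum_i a i *: toR R (circuit_gen i) = 0 -> forall i, a i = 0.
Proof.
move=> a0 i; have coord j : (if j \in c then a j + a (prev c j) else - a j) = 0.
  by rewrite -(sum_circuit_gen_coord a 0) a0 mxE.
have [ic|ic] := boolP (i \in c); last first.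
  by have /eqP := coord i; rewrite (negPf ic) oppr_eq0 => /eqP.
have aS x : x \in c -> a x + a (next c x) = 0.
  by move=> xc; have := coord (next c x); rewrite mem_next xc prev_next // addrC.
suff : a i + a i = 0 by lra.
apply: (alternating_double (S := fun u => u = 0)) ic => // u v -> ->.
by rewrite subr0.
Qed.

Variables (V : {set 'I_n}) (cV : c =i V).

(** Each vertex of the circuit is covered by exactly two generators. *)
Lemma evec_half_sum :
  toR R (evec V) = \sum_i (if i \in c then 2^-1 else 0) *: toR R (circuit_gen i).
Proof.
apply/matrixP => k j; rewrite sum_circuit_gen_coord mxE evec_coord -cV mem_prev.
by case: ifP => jc /=; rewrite jc ?oppr0 //; lra.
Qed.

(** Coefficients off the circuit are opposites of coordinates, hence integers; on
    the circuit they are half-integers of a common class modulo 1, so that [s]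
    is 0 or 1 according to this class. *)
Lemma circuit_cone_lattice_point (a : 'I_n -> R) v :
    (forall i, 0 <= a i) -> toR R v = \sum_i a i *: toR R (circuit_gen i) ->
  exists (N : 'I_n -> nat) (s : nat),
    v = \sum_i circuit_gen i *+ N i + evec V *+ s.
Proof.
move=> a_ge0 vE.
have coord j : (if j \in c then a j + a (prev c j) else - a j) \is a Num.int.
  by rewrite -(sum_circuit_gen_coord a 0) -vE mxE intr_int.
have a_out i : i \notin c -> a i \is a Num.int.
  by move=> /negPf ic; have := coord i; rewrite ic rpredN.
have aS x : x \in c -> a x + a (next c x) \is a Num.int.
  by move=> xc; have := coord (next c x); rewrite mem_next xc prev_next // addrC.
pose S (u : R) : Prop := u \is a Num.int.
have S0 : S 0 by exact: rpred0.
have SB u w : S u -> S w -> S (u - w) by exact: rpredB.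
have a_double x : x \in c -> a x + a x \is a Num.int.
  exact: (alternating_double S0 SB c_uniq c_odd aS).
have a_sub x y : x \in c -> y \in c -> a y - a x \is a Num.int.
  exact: (alternating_sub S0 SB c_uniq c_odd aS).
have [x xc] : exists x, x \in c.
  by case: c c_odd => // x c' _; exists x; rewrite mem_head.
have [ax|ax] := int_or_half_int (a_double _ xc).
  have a_nat i : a i \is a Num.nat.
    rewrite natrEint a_ge0 andbT; have [ic|/a_out //] := boolP (i \in c).
    by rewrite -[a i](subrK (a x)) rpredD // a_sub.
  exists (fun i => Num.truncn (a i)), 0%N.
  by rewrite addr0; apply: nat_coefs.
pose a' i := a i - (if i \in c then 2^-1 else 0).
have a'_nat i : a' i \is a Num.nat.
  rewrite natrEint /a'; have [ic|ic] := boolP (i \in c); last first.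
    by rewrite subr0 a_ge0 andbT a_out.
  have ai : a i - 2^-1 \is a Num.int.
    have -> : a i - 2^-1 = (a i - a x) + (a x - 2^-1) by lra.
    by rewrite rpredD // a_sub.
  (* an integer that is at least -1/2 is nonnegative *)
  rewrite ai /=; have /intrP[m am] := ai; rewrite am ler0z.
  have : -1 < m%:~R :> R by rewrite -am; have := a_ge0 i; lra.
  by rewrite -[-1]/((-1)%:~R) ltr_int; lia.
exists (fun i => Num.truncn (a' i)), 1%N.
apply/eqP; rewrite -subr_eq; apply/eqP; apply: nat_coefs => //.
rewrite /toR raddfB /= -/(toR R _) -/(toR R _) vE evec_half_sum -sumrB.
by apply: eq_bigr => i _; rewrite scalerBl.
Qed.

(** The sum is 2 for a generator on the circuit and 0 for one off it. *)
Lemma circuit_gen_even i : (2 %| \sum_(j in V) circuit_gen i 0 j)%Z.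
Proof.
rewrite /circuit_gen; have [ic|ic] := boolP (i \in c); last first.
  rewrite big1 // => j jV; rewrite !mxE /=.
  by case: eqP jV ic => // -> ; rewrite -cV => ->.
have sum1 k : k \in c -> \sum_(j in V) unit_vec k 0 j = 1.
  rewrite cV => kV; rewrite (bigD1 k) //= big1 => [|j /andP[_ /negPf jk]].
    by rewrite !mxE !eqxx addr0.
  by rewrite !mxE jk.
under eq_bigr do rewrite mxE.
by rewrite big_split /= !sum1 ?mem_next.
Qed.

Lemma sum_evec_odd : ~~ (2 %| \sum_(j in V) evec V 0 j)%Z.
Proof.
have sumE : \sum_(j in V) evec V 0 j = #|V|%:Z.
  rewrite (eq_bigr (fun=> 1)) => [|j jV]; last by rewrite evec_coord jV.
  by rewrite sumr_const -natz.
have size_c : size c = #|V| by rewrite -(card_uniqP c_uniq); apply: eq_card.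
by rewrite sumE -size_c -[(_ \in _)]/(2 %| size c)%N dvdn2 c_odd.
Qed.

Lemma evec_neq_circuit_gen i : (circuit_gen i == evec V) = false.
Proof.
by apply/negP => /eqP gi; have := circuit_gen_even i; rewrite gi (negPf sum_evec_odd).
Qed.

(** A minimal Hilbert basis is extracted from the one made of the generators and
    [evec V] without identifying it: parity prevents the loss of [evec V]. *)
Lemma evec_in_hilbert_step (A : set 'rV[int]_n) :
  (forall i, A (circuit_gen i)) -> hilbert_step R A (evec V).
Proof.
move=> Ag; have [g_inj basisB] := free_toR_basis Ag circuit_gen_free.
set B := [fset _ | i in _]%fset in basisB; pose K : set 'rV[R]_n := cone B.
have evecB : evec V \notin B.
  by apply/imfsetP => -[i _ /eqP]; rewrite eq_sym evec_neq_circuit_gen.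
have hilbertH : hilbert_basis K (evec V |` B)%fset.
  split=> [h|v]; rewrite /lattice_points /K /=.
    rewrite !inE => /orP[/eqP ->|/imfsetP[i _ ->]]; apply/(coneP _ g_inj).
      exists (fun i => if i \in c then 2^-1 else 0); last exact: evec_half_sum.
      by move=> i; case: ifP => // _; rewrite invr_ge0.
    exists (fun j => (i == j)%:R) => [j|]; first exact: ler0n.
    rewrite (bigD1 i) //= eqxx scale1r big1 ?addr0 // => j /negPf ji.
    by rewrite eq_sym ji scale0r.
  move=> /(coneP _ g_inj)[a a_ge0 /(circuit_cone_lattice_point a_ge0)[N [s ->]]].
  exists (fun h => if h == evec V then s else (\sum_(i | circuit_gen i == h) N i)%N).
  rewrite big_fsetU1 //= eqxx sum_imfset // addrC; congr (_ + _).
  apply: eq_bigr => i _; rewrite evec_neq_circuit_gen; congr (_ *+ _).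
  by rewrite -[LHS](coef_of_inj N i g_inj).
have [H minH sH] := sub_min_hilbert_basis hilbertH.
exists B, H; split=> //; apply: contrapT => /negP evecH.
have [[_ genH] _] := minH.
have [|k evecE] := genH (evec V).
  by apply: (hilbertH.1); rewrite !inE eqxx.
move: sum_evec_odd; apply/negP/negPn.
under eq_bigr do rewrite evecE summxE.
rewrite exchange_big /= big_seq; apply: rpred_sum => h hH.
under eq_bigr do rewrite mulmxnE.
rewrite sumrMnl; apply: rpredMn.
move/fsubsetP: sH => /(_ _ hH); rewrite !inE => /orP[/eqP hV|].
  by rewrite -hV hH in evecH.
by case/imfsetP => i _ ->; apply: circuit_gen_even.
Qed.

End OddCircuit.

Lemma rank_normal_in_A1 (R : realType) (n : nat) (e : rel 'I_n)
    (c : seq 'I_n) (V : {set 'I_n}) :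
  odd_circuit e c -> c =i V -> A_iter R e 1 (evec V).
Proof.
case/andP => /and4P[_ e_c c_uniq _] c_odd cV.
apply: (evec_in_hilbert_step R c_uniq c_odd cV) => i; rewrite /circuit_gen.
case: ifPn => ic; last by right; exists i.
by left; exists i, (next c i); split; rewrite // next_cycle.
Qed.

(** * Cyclic orders on a clique *)

Section UniqCycle.
Variables (T : finType) (c : seq T).
Hypotheses (c_uniq : uniq c) (c_ge3 : 3 <= size c).

Lemma next_distinct x : x \in c -> (next c x != x) && (next c (next c x) != x).
Proof.
case/rot_to => i s c_rot; rewrite -!(next_rot i c_uniq) c_rot.
have : uniq (x :: s) by rewrite -c_rot rot_uniq.
have : 3 <= size (x :: s) by rewrite -c_rot size_rot.
case: s {c_rot} => [|y [|z s]] //= _; rewrite !inE !negb_or eqxx.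
case/and3P => /and3P[xy xz _] _ _.
by rewrite (eq_sym y x) (negPf xy) eqxx (eq_sym z) xz.
Qed.

(** A coincidence of two edges would mean going back along the same edge, which
    is possible only on a cycle with two vertices. *)
Lemma uniq_cycle_edges : uniq [seq [set x; next c x]%SET | x <- c].
Proof.
rewrite map_inj_in_uniq // => x y xc yc /setP xy; apply/eqP.
have /andP[_ /negP nnx] := next_distinct xc.
have := xy x; rewrite !inE eqxx => /esym/orP[//|/eqP xE].
have := xy y; rewrite !inE eqxx /= => /orP[/eqP->//|/eqP yE].
by case: nnx; rewrite -yE -xE.
Qed.

End UniqCycle.

(** In a clique every cyclic order of the vertices is a circuit as soon as there
    are three of them. *)
Lemma clique_odd_circuit n (e : rel 'I_n) (K : {set 'I_n}) :
  clique e K -> odd #|K| -> 3 <= #|K| -> odd_circuit e (enum K).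
Proof.
move=> eK K_odd K_ge3; have K_uniq := enum_uniq (mem K).
have sK : 3 <= size (enum K) by rewrite -cardE.
rewrite /odd_circuit /circuit -cardE K_odd andbT K_uniq uniq_cycle_edges // andbT.
apply/andP; split; first by rewrite -size_eq0 -lt0n (ltn_trans _ sK).
apply/andP; split=> //; apply: cycle_from_next => // x xK.
have /andP[nx _] := next_distinct K_uniq sK xK.
by apply: eK; rewrite 1?eq_sym // -mem_enum // mem_next.
Qed.

Theorem corollary4p3 (R : realType) (n : nat) (e : rel 'I_n)
    (e_sym : symmetric e) (e_irr : irreflexive e) :
  (forall V : {set 'I_n},
     (exists c : seq 'I_n, odd_circuit e c /\ c =i V) ->
     A_iter R e 1 (normal (rank_ineq e V)))
  /\ (forall c : seq 'I_n, odd_hole e c ->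
     A_iter R e 1 (normal (odd_hole_ineq c)))
  /\ (forall K : {set 'I_n}, clique e K -> odd #|K| -> 3 <= #|K| ->
     A_iter R e 1 (normal (clique_ineq K))).
Proof.
split; [|split] => [V [c [ec cV]]|c [ec _]|K eK K_odd K_ge3] /=.
- exact: rank_normal_in_A1 ec cV.
- by apply: (rank_normal_in_A1 R ec) => x; rewrite inE.
- apply: (rank_normal_in_A1 R (clique_odd_circuit eK K_odd K_ge3)) => x.
  by rewrite mem_enum.
Qed.
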